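(* Let $p\geq 1$ and $0\leq k<p$ be integers and let $\sigma=\mathrm{ReLU}^p$. For each $N$, let $b_i=-1+2(i-1)/N$ for $i=1,\dots,N$, and let $\mathbf{G}^{(k)}_\sigma\in\mathbb{R}^{N\times N}$ be the matrix with entries $$[\mathbf{G}^{(k)}_\sigma]_{i,j}=\int_{-1}^1 \sigma^{(k)}(x-b_i)\,\sigma^{(k)}(x-b_j)\,dx,\qquad i,j=1,\dots,N,$$ with eigenvalues $\lambda^{(k)}_1\geq\cdots\geq\lambda^{(k)}_N$. Then, as $N\to+\infty$, $$\frac{\lambda^{(k)}_j}{\lambda^{(k)}_N}\sim\frac{N^{2+2(p-k)}}{j^{2+2(p-k)}},\qquad j=1,\dots,N,$$ (i.e. this ratio is bounded above and below by positive constants, independent of $N$ and $j$, times $(N/j)^{2+2(p-k)}$). Consequently the condition number $\kappa(\mathbf{G}^{(k)}_\sigma)=\lambda^{(k)}_1/\lambda^{(k)}_N$ satisfies $\kappa(\mathbf{G}^{(k)}_\sigma)=\Theta(N^{2+2(p-k)})$: there exist constants $c>0$, $C>0$ and an integer $N_0$ such that $cN^{2+2(p-k)}\leq\kappa(\mathbf{G}^{(k)}_\sigma)\leq CN^{2+2(p-k)}$ for all $N\geq N_0$.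
   Context: $\mathrm{ReLU}^p(z)=(\max\{0,z\})^p$ and $\sigma^{(k)}$ denotes the $k$-th derivative of $\sigma$. *)

(* Defs.v *)
From HB Require Import structures.
From mathcomp Require Import all_boot all_order all_algebra.
From mathcomp Require Import all_classical all_reals all_analysis.
Set Implicit Arguments. Unset Strict Implicit. Unset Printing Implicit Defensive.
Import Order.TTheory GRing.Theory Num.Theory.
Import numFieldNormedType.Exports.
Local Open Scope classical_set_scope.
Local Open Scope ring_scope.

Definition relu_pow {R : realType} (p : nat) (z : R) : R := (Num.max 0 z) ^+ p.

Definition sigma_k {R : realType} (p k : nat) : R -> R := derive1n k (relu_pow p).

(* bias b_i = -1 + 2 (i-1)/N for the 1-based index i; here i : 'I_N is 0-based *)
Definition bias {R : realType} (N : nat) (i : nat) : R := -1 + 2 * i%:R / N%:R.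

Definition gram {R : realType} (p k N : nat) : 'M[R]_N :=
  \matrix_(i < N, j < N)
    (\int[@lebesgue_measure R]_(x in `[-1, 1]%classic)
        (sigma_k p k (x - bias N i) * sigma_k p k (x - bias N j)))%R.

Definition sorted_eigenvalues {R : realType} (N : nat) (A : 'M[R]_N) (lam : nat -> R) : Prop :=
  char_poly A = \prod_(j < N) ('X - (lam j)%:P) /\
  (forall i j : nat, (i <= j < N)%N -> lam j <= lam i).

(* Main.v *)
(** Write q = p - k, r = q + 1 and h = 2 / N. The k-th derivative of ReLU^p is a
constant times ReLU^q, so a G a^T is, up to the factor h^(2q+1), the integral
over [0, N] of f^2, where f(y) = sum_i a_i (y - i)_+^q. Let S be the summation
operator (S g)_n = g_0 + ... + g_n. On [n, n+1], f is a polynomial of degree at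
most q whose coefficients are combinations of (S^m a)_n for 1 <= m <= r, and
conversely (S^r a)_n is a linear functional of it; hence the integral lies
between constant multiples of |S^r a|^2 and of the sum of the |S^m a|^2.

By Courant-Fischer it remains to compare |S^m a| with (N / j)^m |a|. If, at the
start of each of about j / r blocks of length about r N / j, the first r
iterated sums of a vanish, then S expands the norm at most by the block
length; this costs at most j linear conditions. In the other direction, the r-th
differences of j translates of a discrete B-spline of width about N / j span a
space on which |S^r a| >= c (N / j)^r |a|. *)

Require Import Defs.
From HB Require Import structures.
From mathcomp Require Import all_boot all_order all_algebra.
From mathcomp Require Import all_classical all_reals all_analysis.
From mathcomp Require Import polyrcf ring lra zify.
Set Implicit Arguments. Unset Strict Implicit. Unset Printing Implicit Defensive.
Import Order.TTheory GRing.Theory Num.Theory.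
Local Open Scope ring_scope.

(** * Courant-Fischer bounds for real symmetric matrices *)

Definition normsq (R : pzRingType) n (v : 'rV[R]_n) : R := \sum_(i < n) v 0 i ^+ 2.
Definition qform (R : pzRingType) n (A : 'M[R]_n) (v : 'rV[R]_n) : R :=
  (v *m A *m v^T) 0 0.

Lemma mulmx_trE (R : comPzRingType) n (v : 'rV[R]_n) : v *m v^T = (normsq v)%:M.
Proof.
by apply/matrixP=> i j; rewrite !ord1 !mxE eqxx; apply: eq_bigr => k _; rewrite mxE expr2.
Qed.

Lemma normsq_ge0 (R : realDomainType) n (v : 'rV[R]_n) : 0 <= normsq v.
Proof. by apply: sumr_ge0 => i _; apply: sqr_ge0. Qed.

Lemma normsq_eq0 (R : realDomainType) n (v : 'rV[R]_n) : (normsq v == 0) = (v == 0).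
Proof.
apply/eqP/eqP => [/psumr_eq0P v0|->]; last first.
  by apply: big1 => i _; rewrite mxE expr0n.
apply/rowP=> i; rewrite mxE; apply/eqP; rewrite -sqrf_eq0 v0 // => k _.
exact: sqr_ge0.
Qed.

Lemma normsq_gt0 (R : realDomainType) n (v : 'rV[R]_n) : (0 < normsq v) = (v != 0).
Proof. by rewrite lt0r normsq_ge0 andbT normsq_eq0. Qed.

Lemma exists_left_kernel (F : fieldType) m n (M : 'M[F]_(m, n)) : (n < m)%N ->
  exists2 v : 'rV_m, v != 0 & v *m M = 0.
Proof.
move=> nm; have: kermx M != 0.
  by rewrite -mxrank_eq0 mxrank_ker -lt0n subn_gt0 (leq_ltn_trans (rank_leq_col M)).
by case/rowV0Pn=> v /sub_kermxP vM v0; exists v.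
Qed.

(* The Householder reflection in the hyperplane orthogonal to e_0 - v. *)
Lemma orthogonal_completion (R : realFieldType) n (v : 'rV[R]_n.+1) : normsq v = 1 ->
  exists2 U : 'M[R]_n.+1, U *m U^T = 1%:M & row 0 U = v.
Proof.
move=> nv; set e : 'rV[R]_n.+1 := delta_mx 0 0.
have [->|ve] := eqVneq v e.
  by exists 1%:M; rewrite ?trmx1 ?mulmx1 // row1.
have [u uE] : {u : 'rV[R]_n.+1 | u = e - v} by exists (e - v).
have u0 : u != 0 by rewrite uE subr_eq0 eq_sym.
have nu := mulmx_trE u; have nu0 : normsq u != 0 by rewrite normsq_eq0.
(* Since e_0 and v are both unit vectors, |e_0 - v|^2 = 2 - 2 v_0. This identity makes the
   reflection send e_0 to e_0 - u = v. *)
have ev : normsq u = 2 * u 0 0.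
  have -> : normsq u = \sum_i (e 0 i ^+ 2 + v 0 i ^+ 2 - 2 * e 0 i * v 0 i).
    by apply: eq_bigr => i _; rewrite uE !mxE; ring.
  rewrite sumrB big_split /= -/(normsq v) nv.
  have eE (f : 'I_n.+1 -> R) : \sum_i e 0 i * f i = f 0.
    rewrite (bigD1 0) //= mxE !eqxx mul1r big1 ?addr0 // => i i0.
    by rewrite mxE (negPf i0) mul0r.
  under eq_bigr do rewrite expr2.
  rewrite eE uE !mxE !eqxx /=.
  under [X in _ - X]eq_bigr do rewrite -mulrA mulrCA.
  rewrite eE; ring.
exists (1%:M - (2 / normsq u) *: (u^T *m u)).
  have -> : (1%:M - (2 / normsq u) *: (u^T *m u))^T =
      1%:M - (2 / normsq u) *: (u^T *m u).
    by rewrite [LHS]raddfB /= [X in _ - X]linearZ /= trmx_mul trmxK tr_scalar_mx.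
  rewrite mulmxBl !mulmxBr !mul1mx !mulmx1 -!scalemxAl -!scalemxAr.
  rewrite mulmxA -(mulmxA _ u) nu mul_mx_scalar -scalemxAl !scalerA.
  set w := u^T *m u; rewrite opprB -!addrA; apply/eqP; rewrite eq_sym -subr_eq0.
  rewrite opprD addrA subrr sub0r oppr_eq0 -!scaleNr -!scalerDl.
  by rewrite (_ : _ + _ = 0) ?scale0r //; field.
rewrite rowE mulmxBr mulmx1 -scalemxAr mulmxA -/e.
have -> : e *m u^T = (u 0 0)%:M.
  apply/matrixP=> i j; rewrite !ord1 mxE (bigD1 0) //= !mxE !eqxx mul1r.
  rewrite big1 ?addr0 ?mulr1n // => k k0.
  by rewrite mxE (negPf k0) mul0r.
rewrite mul_scalar_mx scalerA ev.
rewrite (_ : _ * _ = 1) ?scale1r; last first.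
  by field; apply/eqP=> u00; move: nu0; rewrite ev u00 mulr0 eqxx.
by rewrite uE opprB addrCA subrr addr0.
Qed.

Lemma char_poly_conj (R : comUnitRingType) n (U A : 'M[R]_n) : U *m U^T = 1%:M ->
  char_poly (U *m A *m U^T) = char_poly A.
Proof.
move=> UU; have UU' := mulmx1C UU.
pose V := map_mx polyC U.
have VV : V *m V^T = 1%:M by rewrite map_trmx -map_mxM UU map_scalar_mx.
rewrite /char_poly.
have -> : char_poly_mx (U *m A *m U^T) = V *m char_poly_mx A *m V^T.
  rewrite /char_poly_mx mulmxBr mulmxBl !map_mxM map_trmx.
  by rewrite -map_trmx -/V mul_mx_scalar -scalemxAl VV scalemx1.
by rewrite !det_mulmx mulrAC -det_mulmx VV det1 mul1r.
Qed.

(* Induction on n: deflate along a unit eigenvector for lam 0. *)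
Lemma symmetric_diagonalization (R : rcfType) n (A : 'M[R]_n) (lam : nat -> R) :
  A^T = A -> char_poly A = \prod_(j < n) ('X - (lam j)%:P) ->
  exists2 P : 'M[R]_n, P *m P^T = 1%:M &
    A = P^T *m diag_mx (\row_(j < n) lam j) *m P.
Proof.
elim: n A lam => [|n IHn] A lam symA charA.
  by exists 1%:M; rewrite ?trmx1 ?mulmx1 //; apply/matrixP => [[]].
have : eigenvalue A (lam 0).
  by rewrite eigenvalue_root_char charA big_ord_recl rootM root_XsubC eqxx.
case/eigenvalueP=> v0 Av0 v0N0.
have n0 : 0 < normsq v0 by rewrite normsq_gt0.
pose v := (Num.sqrt (normsq v0))^-1 *: v0.
have nv : normsq v = 1.
  rewrite /normsq; under eq_bigr do rewrite mxE exprMn.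
  rewrite -mulr_sumr -/(normsq v0) exprVn sqr_sqrtr ?ltW // mulVf //.
  by rewrite gt_eqF.
have Av : v *m A = lam 0 *: v.
  by rewrite -scalemxAl Av0 !scalerA mulrC.
have [U UU U0] := orthogonal_completion nv.
have [B BdE] : {B : 'M[R]_(1 + n) | B = U *m A *m U^T} by exists (U *m A *m U^T).
have symB : B^T = B by rewrite BdE !trmx_mul trmxK symA mulmxA.
have row0B : row 0 B = lam 0 *: delta_mx 0 0.
  rewrite BdE !row_mul U0 Av -scalemxAl -U0 -row_mul UU.
  by rewrite row1.
have B0 j : B 0 j = lam 0 * (j == 0)%:R.
  by have /rowP/(_ j) := row0B; rewrite !mxE eqxx.
have Bul : ulsubmx B = (lam 0)%:M.
  by apply/matrixP=> i j; rewrite !ord1 mxE mxE lshift0 B0 mxE eqxx mulr1.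
have Bur : ursubmx B = 0.
  apply/matrixP=> i j; rewrite !ord1 mxE mxE lshift0 B0.
  by rewrite (_ : (_ == _) = false) // mulr0 mxE.
have Bdl : dlsubmx B = 0 by rewrite -[B]symB -trmx_ursub Bur trmx0.
(* The first row of [U] is an eigenvector, so the first row of [B] is [lam 0] times e_0; symmetry
   then clears the first column as well. *)
have BE : B = block_mx (lam 0)%:M 0 0 (drsubmx B).
  by rewrite -[LHS]submxK Bul Bur Bdl.
have charB : char_poly B = ('X - (lam 0)%:P) * char_poly (drsubmx B).
  rewrite {1}BE /char_poly /char_poly_mx map_block_mx !map_mx0.
  rewrite (@scalar_mx_block _ 1 n) opp_block_mx add_block_mx !oppr0 !addr0.
  by rewrite det_ublock det_mx11 !mxE eqxx.
have [||P PP PE] := IHn (drsubmx B) (fun j => lam j.+1).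
- by rewrite trmx_drsub symB.
(* Cancelling the factor X - [lam 0] leaves the remaining [lam] as the roots for the lower block,
   with multiplicity. *)
- apply: (@mulfI _ ('X - (lam 0)%:P)); first by rewrite polyXsubC_eq0.
  by rewrite -charB BdE char_poly_conj // charA big_ord_recl.
pose W : 'M[R]_(1 + n) := block_mx 1%:M 0 0 P.
have WW : W *m W^T = 1%:M.
  rewrite tr_block_mx mulmx_block !trmx0 trmx1 !mulmx0 !mul0mx !addr0 add0r.
  by rewrite PP mulmx1 -scalar_mx_block.
exists (W *m U).
  by rewrite trmx_mul mulmxA -(mulmxA W) UU mulmx1.
have -> : A = U^T *m B *m U.
  by rewrite BdE !mulmxA (mulmx1C UU) mul1mx -mulmxA (mulmx1C UU) mulmx1.
rewrite trmx_mul !mulmxA; congr (_ *m _); rewrite -!mulmxA; congr (_ *m _).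
have -> : \row_(j < n.+1) lam j =
    row_mx (lam 0)%:M (\row_(j < n) lam j.+1) :> 'rV_(1 + n).
  by apply/rowP=> i; rewrite !mxE; case: split_ordP => j ->; rewrite ?ord1 mxE.
rewrite (@diag_mx_row _ n 1).
have BW : B = W^T *m
    (block_mx (diag_mx (lam 0)%:M) 0 0 (diag_mx (\row_(j < n) lam j.+1)) *m W).
  rewrite mulmxA /W tr_block_mx !mulmx_block {1}BE PE.
  rewrite !trmx0 trmx1 !(mulmx0, mul0mx, addr0, add0r, mulmx1, mul1mx).
  by congr block_mx; apply/matrixP=> i j; rewrite !ord1 !mxE eqxx.
exact: BW.
Qed.

Lemma qform_diagonal (R : rcfType) n (A : 'M[R]_n) (lam : nat -> R) :
  A^T = A -> char_poly A = \prod_(j < n) ('X - (lam j)%:P) ->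
  exists P : 'M[R]_n, forall v : 'rV[R]_n,
    normsq v = normsq (v *m P) /\
    qform A v = \sum_(i < n) lam i * (v *m P) 0 i ^+ 2.
Proof.
move=> symA charA; have [P PP AE] := symmetric_diagonalization symA charA.
exists P^T => v; split.
  have nE (w : 'rV[R]_n) : normsq w = (w *m w^T) 0 0 by rewrite mulmx_trE mxE eqxx.
  by rewrite !nE trmx_mul trmxK mulmxA -(mulmxA v) (mulmx1C PP) mulmx1.
rewrite /qform AE !mulmxA -(mulmxA _ P) mul_mx_diag mxE; apply: eq_bigr => i _.
have -> : (P *m v^T) i 0 = (v *m P^T) 0 i by rewrite -[P]trmxK -trmx_mul mxE trmxK.
by rewrite mxE [X in _ * X * _]mxE mulrAC -expr2 mulrC.
Qed.

Section CourantFischer.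
Variables (R : rcfType) (n : nat) (A : 'M[R]_n) (lam : nat -> R).
Hypotheses (symA : A^T = A) (charA : char_poly A = \prod_(j < n) ('X - (lam j)%:P)).
Hypothesis lam_desc : forall i j, (i <= j < n)%N -> lam j <= lam i.

(** Dimension count: the image of [B] has dimension j + 1, so it contains a nonzero v whose first j
    eigencoordinates vanish. On such a v the form is at most [lam j] |v|^2. *)
Lemma eigenvalue_ge_of_subspace (j : nat) (mu : R) (B : 'M[R]_(j.+1, n)) :
  (j < n)%N -> (forall x : 'rV_j.+1, x *m B = 0 -> x = 0) ->
  (forall x : 'rV_j.+1, mu * normsq (x *m B) <= qform A (x *m B)) ->
  mu <= lam j.
Proof.
move=> jn injB QB; have [P PE] := qform_diagonal symA charA.
pose K : 'M[R]_(j.+1, j) := \matrix_(s, i) (B *m P) s (widen_ord (ltnW jn) i).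
have [x x0 xK] := exists_left_kernel K (ltnSn j).
set v := x *m B; have v0 : v != 0 by apply: contra_neq x0; apply: injB.
have {}xK (i : 'I_n) : (i < j)%N -> (v *m P) 0 i = 0.
  move=> ij; transitivity ((x *m K) 0 (Ordinal ij)); last by rewrite xK mxE.
  rewrite -mulmxA [LHS]mxE [RHS]mxE.
  by apply: eq_bigr => s _; rewrite [K _ _]mxE; congr (_ * (_ *m _) _ _); apply: val_inj.
have [nE qE] := PE v; rewrite -(ler_pM2r (_ : 0 < normsq v)) ?normsq_gt0 //.
apply: le_trans (QB x) _; rewrite -/v qE nE mulr_sumr; apply: ler_sum => i _.
case: (ltnP i j) => ij; first by rewrite xK // expr0n !mulr0.
by rewrite ler_wpM2r ?sqr_ge0 // lam_desc ?ij /=.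
Qed.

(** The m <= j conditions from [K], together with the vanishing of the n - j - 1 eigencoordinates
    after j, number fewer than n. Some nonzero v satisfies them all, and on it the form is at least
    [lam j] |v|^2. *)
Lemma eigenvalue_le_of_codim (j m : nat) (mu : R) (K : 'M[R]_(n, m)) :
  (j < n)%N -> (m <= j)%N ->
  (forall v : 'rV_n, v *m K = 0 -> qform A v <= mu * normsq v) ->
  lam j <= mu.
Proof.
move=> jn mj QK; have [P PE] := qform_diagonal symA charA.
pose T : 'M[R]_(n, m + (n - j.+1)) :=
  row_mx K (\matrix_(s, i) P s (cast_ord (subnKC jn) (rshift j.+1 i))).
have [|v v0] := @exists_left_kernel _ _ _ T.
  by rewrite -[X in (_ < X)%N](subnKC jn) ltn_add2r ltnS.
rewrite mul_mx_row => /eqP; rewrite row_mx_eq0 => /andP[/eqP vK /eqP vP].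
have {}vP (i : 'I_n) : (j < i)%N -> (v *m P) 0 i = 0.
  move=> ij; have ij' : (i - j.+1 < n - j.+1)%N by rewrite ltn_sub2r // (leq_ltn_trans ij).
  have /rowP/(_ (Ordinal ij')) := vP; rewrite [RHS]mxE; apply: etrans.
  rewrite [LHS]mxE [RHS]mxE.
  apply: eq_bigr => s _; rewrite [in RHS]mxE; congr (_ * P _ _); apply: val_inj => /=.
  by rewrite subnKC.
have [nE qE] := PE v; rewrite -(ler_pM2r (_ : 0 < normsq v)) ?normsq_gt0 //.
apply: le_trans (QK v vK); rewrite qE nE mulr_sumr; apply: ler_sum => i _.
case: (leqP i j) => ij; last by rewrite vP // expr0n !mulr0.
by rewrite ler_wpM2r ?sqr_ge0 // lam_desc ?ij /=.
Qed.

End CourantFischer.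

(** * Iterated summation *)

Lemma sum_blocks (R : nmodType) (M L : nat) (F : nat -> R) :
  \sum_(n < M * L) F n = \sum_(b < M) \sum_(k < L) F (b * L + k)%N.
Proof.
elim: M => [|M IHM]; first by rewrite !big_ord0.
by rewrite mulSnr big_split_ord /= IHM [RHS]big_ord_recr.
Qed.

Lemma sqr_sum_le (R : realDomainType) (n : nat) (g : nat -> R) :
  (\sum_(t < n) g t) ^+ 2 <= n%:R * \sum_(t < n) g t ^+ 2.
Proof.
elim: n => [|n IHn]; first by rewrite !big_ord0 mul0r expr0n.
rewrite !big_ord_recr /= sqrrD.
(* The cross term is bounded summand by summand through 2ab <= a^2 + b^2. *)
have : (\sum_(t < n) g t) * g n *+ 2 <= \sum_(t < n) g t ^+ 2 + n%:R * g n ^+ 2.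
  rewrite mulr_suml -sumrMnl mulr_natl -[X in _ *+ X]card_ord -sumr_const.
  rewrite -big_split /=; apply: ler_sum => t _.
  by have := sqr_ge0 (g t - g n); rewrite sqrrB; lra.
by move: IHn; rewrite -natr1; lra.
Qed.

Definition psum (R : nmodType) (g : nat -> R) (n : nat) : R := \sum_(i < n.+1) g i.

Lemma eq_iter_psum (R : nmodType) k (f g : nat -> R) :
  f =1 g -> iter k (@psum R) f =1 iter k (@psum R) g.
Proof. by move=> fg; elim: k => [|k IHk] n //=; apply: eq_bigr => i _. Qed.

Lemma psumS (R : nmodType) (g : nat -> R) n : psum g n.+1 = psum g n + g n.+1.
Proof. by rewrite /psum big_ord_recr. Qed.

(** Summing q + 1 times is convolution with the coefficients of (1 - X)^-(q+1); the induction is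
    Pascal's rule. *)
Lemma iter_psum_bin (R : nzRingType) q (a : nat -> R) n :
  iter q.+1 (@psum R) a n = \sum_(i < n.+1) a i * 'C(n - i + q, q)%:R.
Proof.
elim: q n => [|q IHq] n.
  by apply: eq_bigr => i _; rewrite bin0 mulr1.
elim: n => [|n IHn].
  by rewrite iterS /psum big_ord1 IHq !big_ord1 !binn.
rewrite iterS psumS -iterS IHn IHq !(big_ord_recr n.+1) /= addrA -big_split /=.
rewrite !subnn !add0n !binn; congr (_ + _); apply: eq_bigr => i _.
rewrite -mulrDr -natrD; congr (_ * _%:R).
have i_n := ltn_ord i; have -> : (n.+1 - i + q.+1 = (n - i + q.+1).+1)%N by lia.
rewrite binS; congr (_ + 'C(_, _))%N; lia.
Qed.

(** A discrete Poincaré inequality. As the sum up to the start of the block is zero, each partial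
    sum in the block involves at most L terms, all from that block, and Cauchy-Schwarz applies. *)
Lemma psum_block_le (R : realDomainType) (L b : nat) (a : nat -> R) :
  \sum_(i < b * L) a i = 0 ->
  \sum_(k < L) psum a (b * L + k) ^+ 2 <= L%:R ^+ 2 * \sum_(k < L) a (b * L + k)%N ^+ 2.
Proof.
move=> a0; set T := \sum_(k < L) a _ ^+ 2.
have step (k : 'I_L) : psum a (b * L + k) ^+ 2 <= L%:R * T.
  rewrite /psum -addnS big_split_ord /= a0 add0r.
  apply: le_trans (sqr_sum_le _ (fun t => a (b * L + t)%N)) _.
  rewrite ler_pM ?ler0n ?ler_nat ?sumr_ge0 // => [? _|]; first exact: sqr_ge0.
  rewrite (big_ord_widen L (fun t => a (b * L + t)%N ^+ 2)) //.
  by rewrite [T](bigID (fun t : 'I_L => (t < k.+1)%N)) /= lerDl sumr_ge0 // => *;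
    apply: sqr_ge0.
apply: le_trans (ler_sum _ (fun k _ => step k)) _.
by rewrite sumr_const card_ord -[X in X <= _]mulr_natl mulrA expr2.
Qed.

Lemma iter_psum_le (R : realDomainType) (M L r : nat) (a : nat -> R) :
  (forall k b, (k < r)%N -> (b < M)%N -> \sum_(i < b * L) iter k (@psum R) a i = 0) ->
  \sum_(n < M * L) iter r (@psum R) a n ^+ 2 <=
    L%:R ^+ (2 * r) * \sum_(n < M * L) a n ^+ 2.
Proof.
elim: r => [|r IHr] a0; first by rewrite muln0 mul1r.
have {IHr} IH := IHr (fun k b kr => a0 k b (ltnW kr)).
rewrite mulnS exprD -mulrA; apply: le_trans (ler_wpM2l (exprn_ge0 2 (ler0n R L)) IH).
rewrite (sum_blocks _ _ (fun n => iter r.+1 (@psum R) a n ^+ 2)).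
rewrite (sum_blocks _ _ (fun n => iter r (@psum R) a n ^+ 2)) mulr_sumr.
by apply: ler_sum => b _; apply: psum_block_le; apply: a0.
Qed.

(** On generating functions, summation is division by 1 - X. *)
Lemma psum_coef (R : nzRingType) (w : {poly R}) n :
  psum (fun i => ((1 - 'X) * w)`_i) n = w`_n.
Proof.
have E i : ((1 - 'X) * w)`_i = w`_i - (if i == 0%N then 0 else w`_i.-1).
  by rewrite mulrBl mul1r coefB coefXM.
elim: n => [|n IHn]; first by rewrite /psum big_ord1 E subr0.
by rewrite psumS IHn E /= addrC subrK.
Qed.

Lemma iter_psum_coef (R : nzRingType) r (w : {poly R}) n :
  iter r (@psum R) (fun i => ((1 - 'X) ^+ r * w)`_i) n = w`_n.
Proof.
elim: r w n => [|r IHr] w n; first by rewrite mul1r.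
rewrite iterSr -[RHS](IHr w n); apply: eq_iter_psum => i.
by rewrite exprS -mulrA psum_coef.
Qed.

(** Extension by zero lets sums run past N, up to a whole number of blocks. *)
Definition seq_of_row (R : nmodType) N (v : 'rV[R]_N) (n : nat) : R :=
  oapp (v 0) 0 (insub n).

Lemma seq_of_row_ord (R : nmodType) N (v : 'rV[R]_N) (i : 'I_N) : seq_of_row v i = v 0 i.
Proof. by rewrite /seq_of_row valK. Qed.

Lemma seq_of_row_ge (R : nmodType) N (v : 'rV[R]_N) n : (N <= n)%N -> seq_of_row v n = 0.
Proof. by move=> Nn; rewrite /seq_of_row insubN // -leqNgt. Qed.

Lemma sum_seq_of_row (R : pzRingType) N (v : 'rV[R]_N) n : (N <= n)%N ->
  \sum_(i < n) seq_of_row v i ^+ 2 = normsq v.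
Proof.
move=> /subnKC <-; rewrite big_split_ord /= [X in _ + X]big1 ?addr0.
  by apply: eq_bigr => i _; rewrite seq_of_row_ord.
by move=> i _; rewrite seq_of_row_ge ?leq_addr // expr0n.
Qed.

Lemma iter_psum_row (R : comPzRingType) N (v : 'rV[R]_N) k n :
  iter k (@psum R) (seq_of_row v) n =
  \sum_(i < N) v 0 i * iter k (@psum R) (fun s => (s == i)%:R) n.
Proof.
elim: k n => [|k IHk] n /=.
  have [nN|Nn] := ltnP n N.
    rewrite -[n]/(val (Ordinal nN)) seq_of_row_ord (bigD1 (Ordinal nN)) //= eqxx mulr1.
    rewrite big1 ?addr0 // => i; rewrite -val_eqE eq_sym /= => /negPf ->.
    by rewrite mulr0.
  rewrite seq_of_row_ge // big1 // => i _.
  by rewrite gtn_eqF ?mulr0 // (leq_trans _ Nn).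
transitivity (\sum_(m < n.+1) \sum_(i < N)
    v 0 i * iter k (@psum R) (fun s => (s == i)%:R) m).
  by apply: eq_bigr => m _; rewrite IHk.
by rewrite exchange_big /=; apply: eq_bigr => i _; rewrite -mulr_sumr.
Qed.

(** The block starting at 0 imposes nothing because its sums are empty, so [M.+1] blocks cost only
    [M * r] linear conditions. *)
Lemma vanishing_conditions (R : comPzRingType) (N M L r : nat) :
  exists K : 'M[R]_(N, M * r), forall v : 'rV[R]_N, v *m K = 0 ->
    forall k b, (k < r)%N -> (b < M.+1)%N ->
      \sum_(i < b * L) iter k (@psum R) (seq_of_row v) i = 0.
Proof.
(* Column s encodes the block s / r + 1 and the number s mod r of summations. *)
exists (\matrix_(i, s)
  \sum_(t < (s %/ r).+1 * L) iter (s %% r) (@psum R) (fun u => (u == i)%:R) t).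
move=> v vK k [|b] kr; first by rewrite mul0n big_ord0.
rewrite ltnS => bM; have sM : (b * r + k < M * r)%N by nia.
have /rowP/(_ (Ordinal sM)) := vK; rewrite [RHS]mxE; apply: etrans.
rewrite mxE; under eq_bigr do rewrite iter_psum_row.
rewrite exchange_big /=; apply: eq_bigr => i _; rewrite mxE mulr_sumr /=.
by rewrite divnMDl ?(leq_ltn_trans _ kr) // divn_small // addn0 modnMDl modn_small.
Qed.

(* psi is the discrete cardinal B-spline: the coefficients of the (r+1)-fold
   convolution of the indicator of {0, ..., l-1}. *)
Lemma discrete_bspline (R : realDomainType) (r l : nat) : (0 < l)%N ->
  exists phi psi : {poly R}, (1 - 'X) ^+ r * psi = phi /\
    [/\ (size phi <= r.+1 * l)%N, (size psi <= r.+1 * l)%N, phi`_0 = 1,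
        forall n, `|phi`_n| <= 2 ^+ r & psi.[1] = l%:R ^+ r.+1].
Proof.
move=> l0; pose chi : {poly R} := \sum_(i < l) 'X^i.
have chiE : (1 - 'X) * chi = 1 - 'X^l.
  by rewrite -[RHS]opprB subrX1 -mulNr opprB.
have size_chi : (size chi <= l)%N.
  apply: leq_trans (size_sum _ _ _) _; apply/bigmax_leqP => i _.
  by rewrite size_polyXn.
have phiE : (1 - 'X) ^+ r * chi ^+ r.+1 = (1 - 'X^l) ^+ r * chi.
  by rewrite exprSr mulrA -exprMn chiE.
exists ((1 - 'X^l) ^+ r * chi), (chi ^+ r.+1); split=> //; split.
- elim: r {phiE} => [|r IHr]; first by rewrite mul1r mul1n.
  rewrite exprS -mulrA mulrBl mul1r (leq_trans (size_polyD _ _)) // geq_max.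
  rewrite (leq_trans IHr) ?leq_pmul2r //= size_polyN mulrC.
  apply: leq_trans (size_polyMleq _ _) _.
  by rewrite size_polyXn addnS /= mulSn addnC leq_add2l.
- apply: leq_trans (size_poly_exp_leq _ _) _.
  rewrite mulSn mulnC; have : ((size chi).-1 * r.+1 <= l.-1 * r.+1)%N.
    by rewrite leq_mul2r -!subn1 leq_sub2r.
  by move: l0; nia.
- rewrite -horner_coef0 !hornerE expr0n gtn_eqF // subr0 expr1n mul1r.
  rewrite horner_sum; case: (l) l0 => // l' _; rewrite big_ord_recl big1 => [|i _].
    by rewrite addr0 expr0 hornerC.
  by rewrite hornerXn expr0n.
(* The coefficients of [chi] are 0 or 1, and each factor 1 - X^l at most doubles the bound. *)
- elim: r {phiE} => [|r IHr] n.
    rewrite mul1r coef_sum; case: (ltnP n l) => nl.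
      rewrite (bigD1 (Ordinal nl)) //= coefXn eqxx big1 ?addr0 ?normr1 // => i.
      by rewrite -val_eqE coefXn eq_sym /= => /negPf ->.
    by rewrite big1 ?normr0 // => i _; rewrite coefXn gtn_eqF // (leq_trans _ nl).
  rewrite exprS -mulrA mulrBl mul1r coefB coefXnM.
  apply: le_trans (ler_normB _ _) _; rewrite exprS mulr_natl mulr2n lerD //.
  by case: ifP => // _; rewrite normr0 exprn_ge0.
- rewrite !hornerE horner_sum; congr (_ ^+ _).
  under eq_bigr do rewrite hornerXn expr1n.
  by rewrite sumr_const card_ord.
Qed.

(** The rows of [B] are translates of [phi] by multiples of (r + 1) l. Their supports are disjoint,
    as are those of the translates of [psi] obtained by summing r times, so both norms factor
    through |x| and only |phi| and |psi| have to be compared. *)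
Lemma test_space (R : realFieldType) (r l J N : nat) :
  (0 < l)%N -> (J * (r.+1 * l) <= N)%N ->
  exists2 B : 'M[R]_(J, N), (forall x : 'rV_J, x *m B = 0 -> x = 0) &
    forall x : 'rV_J, l%:R ^+ (2 * r) * normsq (x *m B) <=
      4 ^+ r * r.+1%:R ^+ 2 *
      \sum_(n < N) iter r (@psum R) (seq_of_row (x *m B)) n ^+ 2.
Proof.
move=> l0; set m := (r.+1 * l)%N => JN.
have m0 : (0 < m)%N by rewrite muln_gt0.
have [phi [psi [phiE [sphi spsi phi0 phi_le psi1]]]] := discrete_bspline R r l0.
pose comb (x : 'rV[R]_J) (f : {poly R}) : {poly R} :=
  \sum_(b < J) x 0 b *: ('X^(b * m) * f).
have comb_block x (f : {poly R}) (b k : nat) : (size f <= m)%N -> (b < J)%N -> (k < m)%N ->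
    (comb x f)`_(b * m + k) = seq_of_row x b * f`_k.
  move=> sf bJ km; rewrite coef_sum (bigD1 (Ordinal bJ)) //=.
  rewrite coefZ coefXnM ltnNge leq_addr addKn big1 ?addr0 => [|b' bb'].
    by rewrite -[b]/(val (Ordinal bJ)) seq_of_row_ord.
  rewrite coefZ coefXnM; case: ltnP => b'm; first by rewrite mulr0.
  rewrite nth_default ?mulr0 // (leq_trans sf) //.
  have : (b' < b)%N by move: bb'; rewrite -val_eqE /=; nia.
  nia.
have comb_ge x (f : {poly R}) n : (size f <= m)%N -> (J * m <= n)%N -> (comb x f)`_n = 0.
  move=> sf Jn; rewrite coef_sum big1 // => b _; rewrite coefZ coefXnM.
  case: ltnP => bn; first by rewrite mulr0.
  by rewrite nth_default ?mulr0 // (leq_trans sf) //; have := ltn_ord b; nia.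
have comb_norm x (f : {poly R}) n : (size f <= m)%N -> (J * m <= n)%N ->
    \sum_(i < n) (comb x f)`_i ^+ 2 = normsq x * \sum_(k < m) f`_k ^+ 2.
  move=> sf /subnKC <-; rewrite big_split_ord /= [X in _ + X]big1 ?addr0; last first.
    by move=> i _; rewrite comb_ge ?leq_addr // expr0n.
  rewrite (sum_blocks _ _ (fun i => (comb x f)`_i ^+ 2)) mulr_suml.
  apply: eq_bigr => b _; rewrite mulr_sumr; apply: eq_bigr => k _.
  by rewrite comb_block // seq_of_row_ord exprMn.
pose B := \matrix_(b < J, n < N) ('X^(b * m) * phi)`_n.
have BE x : seq_of_row (x *m B) =1 (fun n => (comb x phi)`_n).
  move=> n; have [nN|Nn] := ltnP n N; last first.
    by rewrite seq_of_row_ge // comb_ge // (leq_trans JN).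
  rewrite -[n]/(val (Ordinal nN)) seq_of_row_ord mxE coef_sum.
  by apply: eq_bigr => b _; rewrite mxE coefZ.
exists B => x.
  (* As [phi] has constant coefficient 1, x_b is read off at position b m. *)
  move=> xB; apply/rowP=> b; rewrite mxE.
  have := comb_block x phi b 0%N sphi (ltn_ord b) m0.
  rewrite phi0 mulr1 seq_of_row_ord => <-.
  rewrite -BE xB; case: (ltnP (b * m + 0) N) => bN; last exact: seq_of_row_ge.
  by rewrite -[(_ + _)%N]/(val (Ordinal bN)) seq_of_row_ord mxE.
have wE n : iter r (@psum R) (seq_of_row (x *m B)) n = (comb x psi)`_n.
  rewrite (eq_iter_psum _ (BE x)) -[RHS](iter_psum_coef r); apply: eq_iter_psum => i.
  rewrite /comb mulr_sumr; congr nth; congr polyseq; apply: eq_bigr => b _.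
  by rewrite -scalerAr mulrCA phiE.
under eq_bigr do rewrite wE.
rewrite comb_norm // -(sum_seq_of_row (x *m B) (leqnn N)).
under eq_bigr do rewrite BE.
rewrite comb_norm // mulrCA [X in _ <= X]mulrCA ler_wpM2l ?normsq_ge0 //.
have phi2 : \sum_(k < m) phi`_k ^+ 2 <= m%:R * 4 ^+ r.
  have -> : m%:R * 4 ^+ r = \sum_(k < m) 4 ^+ r :> R.
    by rewrite sumr_const card_ord mulr_natl.
  apply: ler_sum => k _; rewrite -real_normK ?num_real //.
  have -> : 4 ^+ r = (2 ^+ r) ^+ 2 :> R by rewrite -exprM mulnC exprM; congr (_ ^+ _); ring.
  by rewrite ler_pXn2r ?nnegrE ?exprn_ge0.
(* Cauchy-Schwarz on the sum of the coefficients of [psi], which is its value l^(r+1) at 1. *)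
have psi2 : l%:R ^+ (2 * r.+1) <= m%:R * \sum_(k < m) psi`_k ^+ 2.
  rewrite mulnC exprM -psi1; apply: le_trans (sqr_sum_le m (fun k => psi`_k)).
  rewrite (horner_coef_wide _ spsi).
  by under eq_bigr do rewrite expr1n mulr1.
have l0' : 0 < l%:R :> R by rewrite ltr0n.
apply: le_trans (ler_wpM2l (exprn_ge0 _ (ltW l0')) phi2) _.
(* One more factor l completes m = (r + 1) l, so that [psi2] applies without dividing. *)
rewrite -(ler_pM2l l0')
  [X in _ <= X](_ : _ = 4 ^+ r * r.+1%:R * (m%:R * \sum_(k < m) psi`_k ^+ 2)).
  apply: le_trans (ler_wpM2l _ psi2); last by rewrite mulr_ge0 ?exprn_ge0.
  rewrite /m natrM mulnS exprD le_eqVlt; apply/orP; left; apply/eqP; ring.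
by rewrite /m natrM; ring.
Qed.

(** * Integrals of polynomials over the unit interval *)

(** The formal antiderivative without constant term: at i = 0 the quotient is a division by zero,
    whose value is 0. *)
Definition prim (R : fieldType) (p : {poly R}) : {poly R} :=
  \poly_(i < (size p).+1) (p`_i.-1 / i%:R).

Definition integral01 (R : fieldType) (p : {poly R}) : R := (prim p).[1].

Lemma coef_prim (R : fieldType) (p : {poly R}) i : (prim p)`_i = p`_i.-1 / i%:R.
Proof.
rewrite coef_poly; case: ltnP => // si.
by rewrite nth_default ?mul0r // -ltnS prednK // (leq_ltn_trans _ si).
Qed.

Lemma prim_is_linear (R : fieldType) (c : R) (p q : {poly R}) :
  prim (c *: p + q) = c *: prim p + prim q.
Proof.
by apply/polyP=> i; rewrite coefD coefZ !coef_prim coefD coefZ mulrDl mulrA.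
Qed.

Lemma integral01_linear (R : fieldType) : linear_for *%R (@integral01 R).
Proof. by move=> c p q; rewrite /integral01 prim_is_linear hornerD hornerZ. Qed.

HB.instance Definition _ (R : fieldType) :=
  GRing.isLinear.Build R {poly R} R *%R (@integral01 R) (@integral01_linear R).

Lemma deriv_prim (R : numFieldType) (p : {poly R}) : (prim p)^`() = p.
Proof.
apply/polyP=> i; rewrite coef_deriv coef_prim.
by rewrite -[RHS](mulfVK (_ : i.+1%:R != 0)) ?pnatr_eq0 // mulr_natr.
Qed.

Lemma prim0 (R : fieldType) (p : {poly R}) : (prim p).[0] = 0.
Proof. by rewrite horner_coef0 coef_prim invr0 mulr0. Qed.

Section Integral01.
Variable R : rcfType.
Implicit Types p q u : {poly R}.
Local Notation I := (@integral01 R).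

(** The mean value theorem applies to F - [prim p], whose derivative is zero. *)
Lemma horner_antideriv (F p : {poly R}) a b :
  F^`() = p -> a < b -> F.[b] - F.[a] = (prim p).[b] - (prim p).[a].
Proof.
move=> Fp ab; have [c _] := poly_mvt (F - prim p) ab.
rewrite derivB Fp deriv_prim subrr horner0 mul0r !hornerE => /eqP.
by rewrite subr_eq0 => /eqP E; lra.
Qed.

Lemma integral01_antideriv (F p : {poly R}) : F^`() = p -> I p = F.[1] - F.[0].
Proof. by move=> Fp; rewrite (horner_antideriv Fp ltr01) prim0 subr0. Qed.

Let prim_sqr_homo p : {in `[0, 1] &, {homo horner (prim (p ^+ 2)) : x y / x <= y}}.
Proof.
by apply: ler_hornerW => x _; rewrite deriv_prim horner_exp sqr_ge0.
Qed.

Lemma integral01_sqr_ge0 p : 0 <= I (p ^+ 2).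
Proof.
by rewrite /integral01 -(prim0 (p ^+ 2)) prim_sqr_homo // in_itv /= ?lexx ?ler01.
Qed.

Lemma integral01_sqr_eq0 p : I (p ^+ 2) = 0 -> p = 0.
Proof.
move=> I0; set F := prim (p ^+ 2).
have F0 x : 0 <= x <= 1 -> root F x.
  move=> x01; have /andP[x0 x1] := x01; apply/eqP/le_anti/andP; split.
    by rewrite -[X in _ <= X]I0; apply: prim_sqr_homo; rewrite ?in_itv /= ?lexx ?ler01 ?x01.
  by rewrite -(prim0 (p ^+ 2)); apply: prim_sqr_homo; rewrite ?in_itv /= ?lexx ?ler01 ?x01.
have {F0} : F = 0.
  apply/eqP; apply: contraT => Fn0.
  (* The antiderivative of p^2 is monotone and vanishes at 0 and 1, hence on all of [0, 1]. The
     points 1 / (i + 1) give more roots than its degree allows for a nonzero polynomial. *)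
  pose rs : seq R := [seq i.+1%:R^-1 | i <- iota 0 (size F)].
  have := @max_poly_roots _ F rs Fn0; rewrite size_map size_iota ltnn; apply.
    apply/allP=> _ /mapP[i _ ->]; apply: F0.
    by rewrite invr_ge0 ler0n invf_le1 ?ltr0n // ler1n.
  rewrite map_inj_uniq ?iota_uniq // => i j /invr_inj /eqP.
  by rewrite eqr_nat eqSS => /eqP.
move=> /(congr1 (@deriv R)); rewrite deriv_prim deriv0 => /eqP.
by rewrite sqrf_eq0 => /eqP.
Qed.

Lemma integral01_sqrD p q :
  I ((p + q) ^+ 2) = I (p ^+ 2) + 2 * I (p * q) + I (q ^+ 2).
Proof. by rewrite sqrrD mulr2n !linearD /=; ring. Qed.

Lemma integral01_CauchySchwarz p q : I (p * q) ^+ 2 <= I (p ^+ 2) * I (q ^+ 2).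
Proof.
have [q0|q0] := eqVneq (I (q ^+ 2)) 0.
  by rewrite (integral01_sqr_eq0 q0) mulr0 expr0n linear0 expr0n mulr0.
have qp : 0 < I (q ^+ 2) by rewrite lt0r q0 integral01_sqr_ge0.
set c := I (p * q) / I (q ^+ 2).
have := integral01_sqr_ge0 (p + (- c) *: q).
rewrite integral01_sqrD exprZn -scalerAr !linearZ /= sqrrN => H.
rewrite -subr_ge0 -(pmulr_lge0 _ (_ : 0 < (I (q ^+ 2))^-1)) ?invr_gt0 //.
move: H; rewrite /c; congr (0 <= _); field.
exact: q0.
Qed.

(** Prescribed moments are attained because the Gram matrix of the monomials (the Hilbert matrix) is
    invertible: a kernel vector would give a polynomial with zero square integral. *)
Lemma integral01_riesz (n : nat) (phi : nat -> R) :
  exists u, forall s, (s < n)%N -> I (u * 'X^s) = phi s.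
Proof.
pose H : 'M[R]_n := \matrix_(i, j) I ('X^i * 'X^j).
pose pol (v : 'rV[R]_n) : {poly R} := \sum_(i < n) v 0 i *: 'X^i.
have HE v (s : 'I_n) : I (pol v * 'X^s) = (v *m H) 0 s.
  rewrite /pol mulr_suml linear_sum mxE; apply: eq_bigr => i _.
  by rewrite -scalerAl linearZ /= mxE.
have Hunit : H \in unitmx.
  rewrite -row_free_unit -kermx_eq0; apply: contraT => /rowV0Pn[v /sub_kermxP vH v0].
  case/eqP: v0; have pv0 : pol v = 0.
    apply: integral01_sqr_eq0; rewrite expr2 {2}/pol mulr_sumr linear_sum big1 // => s _.
    by rewrite -scalerAr linearZ /= HE vH mxE mulr0.
  apply/rowP=> i; rewrite mxE -[RHS](coef0 R i) -pv0 coef_sum (bigD1 i) //=.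
  rewrite coefZ coefXn eqxx mulr1 big1 ?addr0 // => j ji.
  by rewrite coefZ coefXn eq_sym (inj_eq val_inj) (negPf ji) mulr0.
exists (pol ((\row_j phi j) *m invmx H)) => s sn.
by rewrite (HE _ (Ordinal sn)) mulmxKV // mxE.
Qed.

(** * Shifted powers and binomial coefficients *)

Lemma binomial_poly (q : nat) : exists2 K : {poly R}, (size K <= q.+1)%N &
  forall l, K.[l%:R] = 'C(l + q, q)%:R.
Proof.
elim: q => [|q [K sK KE]].
  by exists 1 => [|l]; rewrite ?size_poly1 // bin0 hornerC.
exists (q.+1%:R^-1 *: (K * ('X + q.+1%:R%:P))) => [|l].
  apply: leq_trans (size_scale_leq _ _) _; apply: leq_trans (size_polyMleq _ _) _.
  by rewrite size_XaddC addn2.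
rewrite hornerZ hornerM KE hornerD hornerX hornerC -natrD -natrM.
rewrite -[RHS](mulKf (_ : q.+1%:R != 0)) ?pnatr_eq0 //.
by rewrite -natrM -mul_bin_diag addnS /= mulnC.
Qed.

(** The binomial is a polynomial in l of degree at most q. Expanding (X + l)^q in powers of l and
    matching coefficients prescribes the moments of u up to order q. Through [iter_psum_bin], this
    recovers an iterated sum from a spline piece. *)
Lemma binomial_functional (q : nat) : exists u, forall l,
  I (u * ('X + l%:R%:P) ^+ q) = 'C(l + q, q)%:R.
Proof.
have [K sK KE] := binomial_poly q.
have [u uE] := integral01_riesz q.+1 (fun s => K`_(q - s) / 'C(q, s)%:R).
exists u => l; rewrite exprDn mulr_sumr linear_sum -KE (horner_coef_wide _ sK).
apply: eq_bigr => i _ /=; have iq : (i <= q)%N by rewrite -ltnS.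
rewrite mulrnAr linearMn /= -polyC_exp mulrA mulrC mul_polyC linearZ /=.
rewrite uE ?ltnS ?leq_subr //.
rewrite subKn // bin_sub // -[LHS]mulr_natr mulrA mulfVK 1?mulrC //.
by rewrite pnatr_eq0 -lt0n bin_gt0.
Qed.

Lemma shifted_power_expansion (q : nat) : exists P : nat -> {poly R}, forall l : nat,
  ('X + l%:R%:P) ^+ q = \sum_(j < q.+1) 'C(l + j, j)%:R *: P j.
Proof.
elim: q => [|q [P PE]].
  by exists (fun=> 1) => l; rewrite big_ord1 bin0 scale1r.
(* Split X + l = (X - (j + 1)) + (l + j + 1); the second term times C(l + j, j) is (j + 1) C(l + j +
   1, j + 1), which moves to index j + 1. *)
exists (fun j => (if (j < q.+1)%N then ('X - j.+1%:R%:P) * P j else 0) +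
  (if j is i.+1 then j%:R *: P i else 0)) => l.
under eq_bigr do rewrite scalerDr.
rewrite big_split /= big_ord_recr /= ltnn scaler0 addr0.
rewrite [X in _ = _ + X]big_ord_recl /= scaler0 add0r -big_split /=.
rewrite exprS PE mulr_sumr; apply: eq_bigr => j _.
rewrite ltn_ord -scalerAr /bump /= add1n scalerA -!mul_polyC.
have -> : 'C(l + j.+1, j.+1)%:R * j.+1%:R = (l%:R + j.+1%:R) * 'C(l + j, j)%:R :> R.
  by rewrite -natrD -!natrM; congr _%:R; rewrite mulnC -mul_bin_diag addnS.
rewrite !(polyCM, polyCD); ring.
Qed.

Lemma integral01_sqr_sum_le m (P : nat -> {poly R}) : exists2 C : R, 0 <= C &
  forall c : nat -> R, I ((\sum_(j < m) c j *: P j) ^+ 2) <= C * \sum_(j < m) c j ^+ 2.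
Proof.
elim: m => [|m [C C0 CP]].
  by exists 0 => // c; rewrite !big_ord0 expr0n linear0 mul0r.
exists (2 * C + 2 * I (P m ^+ 2)).
  by rewrite addr_ge0 ?mulr_ge0 ?integral01_sqr_ge0.
move=> c; rewrite !big_ord_recr /=.
set p := \sum_(j < m) _; set T := \sum_(j < m) _.
(* Positivity of the square of the difference bounds the square of the sum by twice the sum of the
   squares. *)
have := integral01_sqr_ge0 (p + (- c m) *: P m); have := CP c.
rewrite -/p -/T !integral01_sqrD -!scalerAr !exprZn !linearZ /= sqrrN => h1 h2.
have T0 : 0 <= T by apply: sumr_ge0 => i _; apply: sqr_ge0.
have := mulr_ge0 C0 (sqr_ge0 (c m)).
have := mulr_ge0 (integral01_sqr_ge0 (P m)) T0; nra.
Qed.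

(** With X = y - n, this is the restriction to [n, n + 1] of the sum of a_i (y - i)_+^q. *)
Definition spline_piece (q : nat) (a : nat -> R) n : {poly R} :=
  \sum_(i < n.+1) a i *: ('X + (n - i)%:R%:P) ^+ q.

Lemma iter_psum_le_spline_piece (q : nat) : exists2 C : R, 0 < C & forall a n,
  iter q.+1 (@psum R) a n ^+ 2 <= C * I (spline_piece q a n ^+ 2).
Proof.
have [u uE] := binomial_functional q.
(* The added 1 only secures strict positivity. *)
exists (I (u ^+ 2) + 1); first by rewrite ltr_wpDl ?integral01_sqr_ge0.
move=> a n; have -> : iter q.+1 (@psum R) a n = I (u * spline_piece q a n).
  rewrite iter_psum_bin mulr_sumr linear_sum; apply: eq_bigr => i _.
  by rewrite -scalerAr linearZ /= uE.
apply: le_trans (integral01_CauchySchwarz _ _) _.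
by rewrite ler_wpM2r ?integral01_sqr_ge0 // lerDl ler01.
Qed.

Lemma spline_piece_le_iter_psum (q : nat) : exists2 C : R, 0 < C & forall a n,
  I (spline_piece q a n ^+ 2) <= C * \sum_(j < q.+1) iter j.+1 (@psum R) a n ^+ 2.
Proof.
have [P PE] := shifted_power_expansion q.
have [C C0 CP] := integral01_sqr_sum_le q.+1 P.
exists (C + 1) => [|a n]; first by rewrite ltr_wpDl.
have -> : spline_piece q a n = \sum_(j < q.+1) iter j.+1 (@psum R) a n *: P j.
  under [RHS]eq_bigr do rewrite iter_psum_bin scaler_suml.
  rewrite exchange_big /=; apply: eq_bigr => i _; rewrite PE scaler_sumr.
  by apply: eq_bigr => j _; rewrite scalerA.
apply: le_trans (CP (fun j => iter j.+1 (@psum R) a n)) _.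
by rewrite ler_wpM2r ?lerDl ?ler01 // sumr_ge0 // => j _; apply: sqr_ge0.
Qed.

End Integral01.

(** * The Gram matrix as a sum over mesh cells *)

Import numFieldNormedType.Exports.
Local Open Scope classical_set_scope.
Local Open Scope ring_scope.

Section Relu.
Variable R : realType.

(** * Derivatives of powers of ReLU *)

Lemma continuous_relu_pow m : continuous (relu_pow m : R -> R).
Proof.
have -> : (relu_pow m : R -> R) = horner 'X^m \o (Num.max 0 : R -> R).
  by apply/funext => x /=; rewrite hornerXn.
move=> x; apply: continuous_comp; last exact: continuous_horner.
exact: (@continuous_max _ _ (cst 0) id x (@cst_continuous _ _ _ _) (@cvg_id _ _)).
Qed.

Lemma is_derive_relu_pow m (x : R) :
  is_derive x 1 (relu_pow m.+2 : R -> R) (m.+2%:R * relu_pow m.+1 x).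
Proof.
have [x0|x0|<-] := ltgtP 0 x.
- refine (@near_eq_is_derive _ _ _ (horner ('X^(m.+2)) : R -> R) (relu_pow m.+2) x 1 _ _ _).
    near=> y; rewrite /relu_pow hornerXn max_r // ltW //.
    by near: y; exact: lt_nbhsr.
  apply: is_derive_eq; rewrite derivXn hornerMn hornerXn.
  by rewrite /relu_pow max_r ?ltW // mulr_natl.
- refine (@near_eq_is_derive _ _ _ (cst 0 : R -> R) (relu_pow m.+2) x 1 _ _ _).
    near=> y; rewrite /relu_pow max_l ?expr0n // ltW //.
    by near: y; exact: lt_nbhsl.
  by apply: is_derive_eq; rewrite /relu_pow max_l ?ltW // expr0n mulr0.
(* At the kink, the difference quotient at h equals [relu_pow m.+1 h], which tends to 0. *)
- have E : (fun h : R =>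
      h^-1 *: (relu_pow m.+2 (h *: 1 + 0) - relu_pow m.+2 0 : R)) @ 0^' -->
      (m.+2%:R * relu_pow m.+1 0 : R).
    rewrite [X in _ --> X](_ : _ = relu_pow m.+1 0); last first.
      by rewrite /relu_pow maxxx expr0n mulr0.
    apply: (@cvg_trans _ ((relu_pow m.+1 : R -> R) @ 0^')); last first.
      by apply: cvg_within_filter; exact: continuous_relu_pow.
    apply: near_eq_cvg; near=> h.
    have h0 : h != 0 by near: h; exact: nbhs_dnbhs_neq.
    rewrite /relu_pow maxxx !expr0n subr0 addr0 [h *: 1]mulr1.
    have [hp|hn] := leP 0 h; last by rewrite !expr0n scaler0.
    rewrite [h ^+ m.+2]exprS; change (h ^+ m.+1 = h^-1 * (h * h ^+ m.+1)).
    by rewrite mulKf.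
  apply: DeriveDef; first by apply/cvg_ex; eexists; exact: E.
  exact: cvg_lim E.
Unshelve. all: by end_near.
Qed.

Lemma sigma_kE p k : (k < p)%N ->
  sigma_k p k = (fun x : R => (p ^_ k)%:R * relu_pow (p - k) x).
Proof.
elim: k => [|k IHk] kp; first by apply/funext => x; rewrite ffactn0 mul1r subn0.
rewrite /sigma_k derive1nS -/(sigma_k p k) IHk ?(ltnW kp) //; apply/funext => x.
(* As k + 1 < p, the exponent being differentiated is at least 2, so the kink causes no trouble. *)
have -> : (p - k = (p - k.+2).+2)%N by lia.
have -> : (p - k.+1 = (p - k.+2).+1)%N by lia.
have H := is_derive_relu_pow (p - k.+2) x.
rewrite derive1E derive_val.
rewrite [LHS](mulrA (p ^_ k)%:R) ffactnSr natrM; congr (_ * _%:R * _); lia.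
Qed.

(** * Exact integration of the entries and assembly over cells *)

Local Notation mu := (@lebesgue_measure R).

Lemma Rintegral_poly_deriv (F : {poly R}) a b : a < b ->
  (\int[mu]_(x in `[a, b]) F^`().[x])%R = F.[b] - F.[a].
Proof.
move=> ab; rewrite /Rintegral (@continuous_FTC2 _ _ (horner F)) //.
- by apply: continuous_subspaceT => x; apply: continuous_horner.
- split; first by move=> x _; apply: derivable_horner.
  + by apply: cvg_at_right_filter; apply: continuous_horner.
  + by apply: cvg_at_left_filter; apply: continuous_horner.
- by move=> x _; rewrite -derivE.
Qed.

Lemma relu_pow_ge0 q (x : R) : 0 <= x -> relu_pow q x = x ^+ q.
Proof. by move=> x0; rewrite /relu_pow max_r. Qed.

Lemma relu_pow_le0 q (x : R) : (0 < q)%N -> x <= 0 -> relu_pow q x = 0.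
Proof. by move=> q0 x0; rewrite /relu_pow max_l // expr0n gtn_eqF. Qed.

Lemma biasE N n : (bias N n : R) = -1 + 2 / N%:R * n%:R.
Proof. by rewrite /bias mulrAC. Qed.

Lemma bias_le N : (0 < N)%N -> {mono (bias N : nat -> R) : m n / (m <= n)%N >-> m <= n}.
Proof.
move=> N0 m n; rewrite !biasE lerD2l ler_pM2l ?ler_nat //.
by rewrite divr_gt0 ?ltr0n.
Qed.

(* With h = 2 / N, the knot of index n is -1 + h n, so x |-> (x + 1) / h sends
   the knots to integers and [-1, 1] to [0, N]. *)
Lemma Rintegral_relu_pow (q N i j : nat) : (0 < q)%N -> (i < N)%N -> (j < N)%N ->
  let P : {poly R} := ('X - i%:R%:P) ^+ q * ('X - j%:R%:P) ^+ q in
  (\int[mu]_(x in `[(-1)%R, 1%R])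
     (relu_pow q (x - bias N i) * relu_pow q (x - bias N j)))%R =
  (2 / N%:R) ^+ (2 * q).+1 * ((prim P).[N%:R] - (prim P).[(maxn i j)%:R]).
Proof.
move=> q0 iN jN P; have N0 : (0 < N)%N by apply: leq_ltn_trans iN.
have [h hE] : {h : R | h = 2 / N%:R} by exists (2 / N%:R).
have h0 : 0 < h by rewrite hE divr_gt0 ?ltr0n.
rewrite -hE.
have hn0 : h != 0 by rewrite gt_eqF.
set b : R := bias N (maxn i j).
have b1 : b < 1.
  rewrite /b biasE -hE -ltrBrDl -ltr_pdivlMl //.
  have -> : h^-1 * (1 - -1) = N%:R.
    by rewrite hE invf_div; field.
  by rewrite ltr_nat gtn_max iN jN.
have b_ge : -1 <= b by rewrite /b biasE lerDl mulr_ge0 // ltW.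
have ib : bias N i <= b by rewrite bias_le // leq_maxl.
have jb : bias N j <= b by rewrite bias_le // leq_maxr.
pose G := h ^+ (2 * q).+1 *: (prim P \Po (h^-1 *: ('X + 1))).
have G' x : (G^`()).[x] = (x - bias N i) ^+ q * (x - bias N j) ^+ q.
  rewrite /G derivZ deriv_comp deriv_prim derivZ derivD derivX derivC addr0.
  rewrite hornerZ hornerM horner_comp !hornerZ hornerD hornerX !hornerC mulr1.
  rewrite /P hornerM !horner_exp !hornerXsubC !biasE -hE.
  have E n : h^-1 * (x + 1) - n = h^-1 * (x - (-1 + h * n)) by field.
  rewrite !E !exprMn; set A := (x - _) ^+ q; set B := (x - _) ^+ q.
  rewrite exprS mul2n -addnn exprD !exprVn.
  have hq0 : h ^+ q != 0 by rewrite expf_neq0.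
  by field; rewrite hn0.
have GE x : G.[x] = h ^+ (2 * q).+1 * (prim P).[h^-1 * (x + 1)].
  by rewrite /G hornerZ horner_comp hornerZ hornerD hornerX hornerC.
transitivity (\int[mu]_(x in `[b, 1]) G^`().[x])%R; last first.
  rewrite Rintegral_poly_deriv // !GE -mulrBr; congr (_ * (_.[_] - _.[_])).
    by rewrite hE invf_div; field.
  by rewrite /b biasE -hE; field.
(* To the left of the larger knot b one of the two factors vanishes; to its right both are plain
   powers. *)
rewrite [LHS]Rintegral_mkcond [RHS]Rintegral_mkcond; congr Rintegral.
apply/funext => x; rewrite !patchE !mem_setE !in_itv /=.
have [bx|xb] := leP b x; last first.
  case: ifP => // _.
  have [bE|bE] : b = bias N i \/ b = bias N j.
  - by rewrite /b /maxn; case: ifP; auto.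
  - by rewrite relu_pow_le0 ?mul0r // subr_le0 -bE ltW.
  - by rewrite mulrC relu_pow_le0 ?mul0r // subr_le0 -bE ltW.
rewrite (le_trans b_ge bx) /=; case: ifP => // _.
by rewrite G' !relu_pow_ge0 ?subr_ge0 ?(le_trans ib) ?(le_trans jb).
Qed.

Definition spline_basis (q n i : nat) : {poly R} :=
  if (i <= n)%N then ('X + (n - i)%:R%:P) ^+ q else 0.

(** Cells before the larger knot contribute nothing; each later cell contributes an increment of
    [prim P], and these telescope. *)
Lemma sum_integral01_spline_basis (q N i j : nat) : (i < N)%N -> (j < N)%N ->
  let P : {poly R} := ('X - i%:R%:P) ^+ q * ('X - j%:R%:P) ^+ q in
  \sum_(n < N) integral01 (spline_basis q n i * spline_basis q n j) =
  (prim P).[N%:R] - (prim P).[(maxn i j)%:R].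
Proof.
move=> iN jN P; have mN : (maxn i j <= N)%N by rewrite geq_max (ltnW iN) ltnW.
rewrite -(telescope_sumr (fun n => (prim P).[n%:R])) //.
rewrite -(big_mkord predT (fun n => integral01 (spline_basis q n i * spline_basis q n j))).
rewrite (big_cat_nat (n := maxn i j)) //= [X in X + _]big1_seq ?add0r => [|n]; last first.
  rewrite mem_index_iota /= => nm; rewrite /spline_basis.
  have [ni|ni] := leqP i n; last by rewrite mul0r linear0.
  have [nj|nj] := leqP j n; last by rewrite mulr0 linear0.
  by rewrite ltnNge geq_max ni nj in nm.
apply: eq_big_nat => n /andP[]; rewrite geq_max => /andP[ni nj] _.
rewrite (@integral01_antideriv _ (prim P \Po ('X + n%:R%:P))).
  by rewrite !horner_comp !hornerD !hornerX !hornerC add0r nat1r.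
rewrite deriv_comp deriv_prim derivD derivX derivC addr0 mulr1 /P comp_polyM.
have E (k : nat) : (k <= n)%N -> (('X - k%:R%:P) ^+ q) \Po ('X + n%:R%:P) =
    ('X + (n - k)%:R%:P) ^+ q :> {poly R}.
  move=> kn; rewrite rmorphXn /= comp_polyB comp_polyX comp_polyC natrB // polyCB.
  by rewrite addrA.
by rewrite !E // /spline_basis ni nj.
Qed.

Lemma gramE (p k N : nat) (i j : 'I_N) : (k < p)%N ->
  gram p k N i j = (p ^_ k)%:R ^+ 2 * (2 / N%:R) ^+ (2 * (p - k)).+1 *
    \sum_(n < N) integral01 (spline_basis (p - k) n i * spline_basis (p - k) n j) :> R.
Proof.
move=> kp; have q0 : (0 < p - k)%N by rewrite subn_gt0.
rewrite sum_integral01_spline_basis // -mulrA -Rintegral_relu_pow // mxE sigma_kE //.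
rewrite -RintegralZl //=; first by apply: eq_Rintegral => x _; ring.
apply: continuous_compact_integrable; first exact: segment_compact.
apply: continuous_subspaceT.
have shift c : continuous (fun y : R => relu_pow (p - k) (y - c)).
  move=> y; apply: (@continuous_comp _ _ _ (fun z => z - c) (relu_pow (p - k))).
    by apply: cvgB; [exact: cvg_id | exact: cvg_cst].
  exact: continuous_relu_pow.
suff H : continuous (fun y : R => relu_pow (p - k) (y - bias N i) *
    relu_pow (p - k) (y - bias N j)) by exact: H.
by move=> y; apply: cvgM; apply: shift.
Qed.

Lemma gram_sym (p k N : nat) : (gram p k N)^T = gram p k N :> 'M[R]_N.
Proof.
by apply/matrixP=> i j; rewrite !mxE; apply: eq_Rintegral => x _; rewrite mulrC.
Qed.

Lemma qform_gram (p k N : nat) (v : 'rV[R]_N) : (k < p)%N ->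
  qform (gram p k N) v = (p ^_ k)%:R ^+ 2 * (2 / N%:R) ^+ (2 * (p - k)).+1 *
    \sum_(n < N) integral01 (spline_piece (p - k) (seq_of_row v) n ^+ 2).
Proof.
move=> kp; set q := (p - k)%N.
have pieceE (n : 'I_N) : spline_piece q (seq_of_row v) n =
    \sum_(i < N) v 0 i *: spline_basis q n i.
  rewrite /spline_piece (big_ord_widen N
    (fun i => seq_of_row v i *: ('X + (n - i)%:R%:P) ^+ q)) // big_mkcond /=.
  apply: eq_bigr => i _; rewrite /spline_basis ltnS.
  by case: ifP => _; rewrite ?scaler0 // seq_of_row_ord.
have sqE (n : 'I_N) : integral01 (spline_piece q (seq_of_row v) n ^+ 2) =
    \sum_(j < N) \sum_(i < N)
      v 0 i * v 0 j * integral01 (spline_basis q n i * spline_basis q n j).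
  rewrite pieceE expr2 [X in integral01 X]big_distrlr exchange_big /=.
  rewrite linear_sum /=; apply: eq_bigr => j _.
  rewrite linear_sum; apply: eq_bigr => i _ /=.
  by rewrite -scalerAl -scalerAr !linearZ /= mulrA.
under [in RHS]eq_bigr do rewrite sqE.
rewrite /qform mxE exchange_big mulr_sumr; apply: eq_bigr => j _.
rewrite mxE mulr_suml exchange_big mulr_sumr; apply: eq_bigr => i _ /=.
rewrite gramE // mxE -mulr_sumr; ring.
Qed.

End Relu.

(** * Eigenvalue bounds *)

Lemma sum_sqr_le_psum (R : realDomainType) N (a : nat -> R) :
  \sum_(n < N) a n ^+ 2 <= 4 * \sum_(n < N) psum a n ^+ 2.
Proof.
case: N => [|N]; first by rewrite !big_ord0 mulr0.
(* The boundary term makes the induction close: with c the last partial sum and d the new entry, the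
   slack gained is (2c + d)^2. *)
suff: \sum_(n < N.+1) a n ^+ 2 + 2 * psum a N ^+ 2 <= 4 * \sum_(n < N.+1) psum a n ^+ 2.
  by apply: le_trans; rewrite lerDl mulr_ge0 ?sqr_ge0.
elim: N => [|N IHN].
  by rewrite !big_ord1 /psum big_ord1; have := sqr_ge0 (a 0%N); lra.
rewrite (big_ord_recr N.+1) [X in _ <= 4 * X](big_ord_recr N.+1) /=.
move: IHN; rewrite psumS.
move: (psum a N) (a N.+1) => c d; have := sqr_ge0 (2 * c + d); nra.
Qed.

Lemma sum_sqr_le_iter_psum (R : realDomainType) r N (a : nat -> R) :
  \sum_(n < N) a n ^+ 2 <= 4 ^+ r * \sum_(n < N) iter r (@psum R) a n ^+ 2.
Proof.
elim: r => [|r IHr]; first by rewrite mul1r.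
apply: le_trans IHr _; rewrite exprSr -mulrA ler_wpM2l ?exprn_ge0 //.
exact: sum_sqr_le_psum.
Qed.

Section Eigenvalues.
Variables (R : realType) (p k : nat).
Hypothesis kp : (k < p)%N.
Let r := (p - k).+1.
(** The scale factor of [qform_gram], not a condition number; it cancels in ratios of
    eigenvalues. *)
Let kappa N : R := (p ^_ k)%:R ^+ 2 * (2 / N%:R) ^+ (2 * (p - k)).+1.

Lemma gram_scale_gt0 N : (0 < N)%N -> 0 < kappa N.
Proof.
move=> N0; rewrite mulr_gt0 ?exprn_gt0 ?divr_gt0 ?ltr0n //.
by rewrite ffact_gt0 ltnW.
Qed.

Lemma gram_eigenvalue_ge : exists2 c : R, 0 < c &
  forall N (lam : nat -> R) j, (j < N)%N -> sorted_eigenvalues (gram p k N) lam ->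
    c * (kappa N * (N%:R / j.+1%:R) ^+ (2 * r)) <= lam j.
Proof.
have [C1 C1_gt0 C1P] := iter_psum_le_spline_piece R (p - k).
pose D : R := 4 ^+ r * r.+1%:R ^+ 2 * C1.
have D0 : 0 < D by rewrite !mulr_gt0 ?exprn_gt0.
pose e : R := 2 * r.+1%:R; have e0 : 0 < e by rewrite mulr_gt0.
exists ((D * e ^+ (2 * r))^-1); first by rewrite invr_gt0 mulr_gt0 ?exprn_gt0.
move=> N lam j jN [charA desc]; set x : R := N%:R / j.+1%:R.
have N0 : (0 < N)%N by apply: leq_ltn_trans jN.
have K0 := gram_scale_gt0 N0.
have QP v : kappa N * \sum_(n < N) iter r (@psum R) (seq_of_row v) n ^+ 2 <=
    C1 * qform (gram p k N) v.
  rewrite qform_gram // mulrCA ler_wpM2l ?(ltW K0) // mulr_sumr.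
  by apply: ler_sum => n _; apply: C1P.
(* Here y stands for the B-spline parameter l, the integer part of N / ((j + 1)(r + 1)). If l >= 1,
   rounding costs at most a factor 2, whence [e]. If l = 0, N / (j + 1) is bounded and y = 1
   suffices. *)
suff [y y0 [xy ylam]] : exists2 y : R, 0 <= y &
    x <= e * y /\ kappa N * y ^+ (2 * r) <= D * lam j.
  have xe : x ^+ (2 * r) <= e ^+ (2 * r) * y ^+ (2 * r).
    by rewrite -exprMn lerXn2r ?nnegrE ?divr_ge0 ?mulr_ge0 // ltW.
  rewrite mulrC ler_pdivrMr ?mulr_gt0 ?exprn_gt0 //.
  apply: le_trans (ler_wpM2l (ltW K0) xe) _.
  have := ler_wpM2l (exprn_ge0 (2 * r) (ltW e0)) ylam; lra.
have [l0|l0] := posnP (N %/ (j.+1 * r.+1)).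
  exists 1 => //; split.
    rewrite mulr1 ler_pdivrMr ?ltr0n // /e -!natrM ler_nat.
    have := ltn_ceil N (isT : 0 < j.+1 * r.+1)%N; rewrite l0; nia.
  rewrite expr1n mulr1 mulrC -ler_pdivrMr //.
  apply: (eigenvalue_ge_of_subspace (gram_sym R p k N) charA desc
    (B := pid_mx j.+1) jN) => y.
    move/eqP; rewrite mulmx_free_eq0 => [/eqP //|].
    by rewrite /row_free rank_pid_mx.
  set v := y *m _; rewrite mulrAC ler_pdivrMr // mulrC.
  apply: le_trans (_ : kappa N *
    (4 ^+ r * \sum_(n < N) iter r (@psum R) (seq_of_row v) n ^+ 2) <= _).
    rewrite mulrC ler_wpM2l ?(ltW K0) // -(sum_seq_of_row v (leqnn N)).
    exact: sum_sqr_le_iter_psum.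
  rewrite mulrCA; apply: le_trans (ler_wpM2l (exprn_ge0 _ _) (QP v)) _ => //.
  have Q0 : 0 <= C1 * qform (gram p k N) v.
    apply: le_trans (QP v); rewrite mulr_ge0 ?(ltW K0) // sumr_ge0 // => n _.
    exact: sqr_ge0.
  have -> : qform (gram p k N) v * D =
      4 ^+ r * (r.+1%:R ^+ 2 * (C1 * qform (gram p k N) v)) by rewrite /D; ring.
  rewrite ler_wpM2l ?exprn_ge0 // ler_peMl //.
  by rewrite exprn_ege1 // ler1n.
set l := (N %/ (j.+1 * r.+1))%N in l0.
exists l%:R => //; split.
  rewrite ler_pdivrMr ?ltr0n // /e -!natrM ler_nat.
  have := ltn_ceil N (isT : 0 < j.+1 * r.+1)%N; rewrite -/l; nia.
rewrite [D * _]mulrC -ler_pdivrMr //.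
have lN : (j.+1 * (r.+1 * l) <= N)%N.
  by rewrite mulnA mulnC leq_trunc_div.
have [B injB BP] := @test_space R r l j.+1 N l0 lN.
apply: (eigenvalue_ge_of_subspace (gram_sym R p k N) charA desc jN injB) => y.
set v := y *m B; rewrite mulrAC ler_pdivrMr // -mulrA.
apply: le_trans (ler_wpM2l (ltW K0) (BP y)) _; rewrite -/v mulrCA.
apply: le_trans (ler_wpM2l _ (QP v)) _; first by rewrite mulr_ge0 ?exprn_ge0.
by rewrite /D mulrA mulrC.
Qed.

Lemma gram_eigenvalue_le : exists2 c : R, 0 < c &
  forall N (lam : nat -> R) j, (j < N)%N -> sorted_eigenvalues (gram p k N) lam ->
    lam j <= c * (kappa N * (N%:R / j.+1%:R) ^+ (2 * r)).
Proof.
have [C2 C2_gt0 C2P] := spline_piece_le_iter_psum R (p - k).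
exists (C2 * r%:R * (2 * r%:R) ^+ (2 * r)).
  by rewrite !mulr_gt0 ?exprn_gt0 ?mulr_gt0 ?ltr0n.
move=> N lam j jN [charA desc]; set x : R := N%:R / j.+1%:R.
have N0 : (0 < N)%N by apply: leq_ltn_trans jN.
have K0 := gram_scale_gt0 N0.
(* The choice of M keeps the M r conditions within j, and M + 1 blocks of length L cover N. *)
pose M := (j %/ r)%N; pose L := (N %/ M.+1).+1.
have Mj : (M * r <= j)%N by apply: leq_trunc_div.
have jM : (j < M.+1 * r)%N by apply: ltn_ceil.
have NL : (N <= M.+1 * L)%N by rewrite mulnC ltnW // ltn_ceil.
(* L is at most 2N / (M + 1) because M + 1 <= N, and j + 1 <= (M + 1) r. *)
have Lx : L%:R <= 2 * r%:R * x.
  rewrite mulrA ler_pdivlMr ?ltr0n // -!natrM ler_nat.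
  have : (N %/ M.+1 * M.+1 <= N)%N by apply: leq_trunc_div.
  have : (M < N)%N by apply: leq_ltn_trans jN; apply: leq_div.
  rewrite /L; nia.
have [K KP] := vanishing_conditions R N M L r.
have {KP} QP v : v *m K = 0 ->
    qform (gram p k N) v <= kappa N * (C2 * r%:R * L%:R ^+ (2 * r)) * normsq v.
  move=> /KP v0; rewrite qform_gram // -/(kappa N) -[X in _ <= X]mulrA.
  rewrite ler_wpM2l ?(ltW K0) //.
  apply: le_trans (ler_sum _ (fun (n : 'I_N) _ => C2P (seq_of_row v) n)) _.
  rewrite -mulr_sumr -!mulrA ler_wpM2l ?(ltW C2_gt0) // exchange_big /=.
  rewrite [X in _ <= X]mulr_natl -[X in _ *+ X]card_ord -sumr_const.
  apply: ler_sum => m _.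
  have -> : normsq v = \sum_(n < M.+1 * L) seq_of_row v n ^+ 2 by rewrite sum_seq_of_row.
  apply: le_trans (_ : \sum_(n < M.+1 * L) iter m.+1 (@psum R) (seq_of_row v) n ^+ 2 <= _).
    rewrite (big_ord_widen _ (fun n => iter m.+1 (@psum R) (seq_of_row v) n ^+ 2) NL).
    rewrite [X in _ <= X](bigID (fun n : 'I__ => (n < N)%N)) /= lerDl sumr_ge0 // => n _.
    exact: sqr_ge0.
  apply: le_trans (iter_psum_le _) _ => [k' b k'm|].
    by apply: v0; apply: leq_trans k'm _.
  rewrite ler_wpM2r ?sumr_ge0 // => [n _|]; first exact: sqr_ge0.
  (* Since L >= 1, the largest order r dominates the other r - 1 terms. *)
  by rewrite ler_weXn2l ?ler1n // leq_mul2l ltn_ord.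
apply: le_trans (eigenvalue_le_of_codim (gram_sym R p k N) charA desc jN Mj QP) _.
rewrite [X in _ <= X]mulrCA ler_wpM2l ?(ltW K0) // -[X in _ <= X]mulrA.
rewrite ler_wpM2l ?mulr_ge0 ?ler0n ?(ltW C2_gt0) // -exprMn.
by rewrite lerXn2r ?nnegrE ?ler0n // !mulr_ge0 ?invr_ge0.
Qed.

End Eigenvalues.

Theorem theorem3 (R : realType) (p k : nat) (hp : (1 <= p)%N) (hk : (k < p)%N) :
  (exists (c C : R) (N0 : nat), 0 < c /\ 0 < C /\
     forall (N : nat) (lam : nat -> R), (N0 <= N)%N ->
       sorted_eigenvalues (gram p k N) lam ->
       forall j : nat, (j < N)%N ->
         c * (N%:R / j.+1%:R) ^+ (2 + 2 * (p - k)) <= lam j / lam N.-1 /\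
         lam j / lam N.-1 <= C * (N%:R / j.+1%:R) ^+ (2 + 2 * (p - k)))
  /\
  (exists (c C : R) (N0 : nat), 0 < c /\ 0 < C /\
     forall (N : nat) (lam : nat -> R), (N0 <= N)%N ->
       sorted_eigenvalues (gram p k N) lam ->
       c * N%:R ^+ (2 + 2 * (p - k)) <= lam 0%N / lam N.-1 /\
       lam 0%N / lam N.-1 <= C * N%:R ^+ (2 + 2 * (p - k))).
Proof.
have [c1 c1_gt0 lamge] := gram_eigenvalue_ge R hk.
have [c2 c2_gt0 lamle] := gram_eigenvalue_le R hk.
have ratio N (lam : nat -> R) j : (j < N)%N -> sorted_eigenvalues (gram p k N) lam ->
    c1 / c2 * (N%:R / j.+1%:R) ^+ (2 + 2 * (p - k)) <= lam j / lam N.-1 /\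
    lam j / lam N.-1 <= c2 / c1 * (N%:R / j.+1%:R) ^+ (2 + 2 * (p - k)).
  move=> jN ev; have N0 : (0 < N)%N by apply: leq_ltn_trans jN.
  have N1 : (N.-1 < N)%N by rewrite ltn_predL.
  have K0 := gram_scale_gt0 R hk N0.
  have := lamge N lam _ N1 ev; have := lamle N lam _ N1 ev.
  have := lamge N lam _ jN ev; have := lamle N lam _ jN ev.
  (* For the last eigenvalue N / j is N / N = 1, so it is comparable to the scale factor alone. *)
  rewrite prednK // divff ?pnatr_eq0 -?lt0n // expr1n mulr1 mulnS.
  set K := (_ * _ ^+ (2 * (p - k)).+1) in K0 *.
  set X := (_ / _) ^+ _; have X0 : 0 <= X by rewrite exprn_ge0 // divr_ge0.
  move=> h1 h2 h3 h4.
  have l0 : 0 < lam N.-1 by apply: lt_le_trans h4; rewrite mulr_gt0.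
  split.
    rewrite ler_pdivlMr //; apply: le_trans h2.
    have -> : c1 * (K * X) = c1 / c2 * X * (c2 * K) by field; rewrite gt_eqF.
    by rewrite ler_wpM2l // mulr_ge0 // divr_ge0 // ltW.
  rewrite ler_pdivrMr //; apply: le_trans h1 _.
  have -> : c2 * (K * X) = c2 / c1 * X * (c1 * K) by field; rewrite gt_eqF.
  by rewrite ler_wpM2l // mulr_ge0 // divr_ge0 // ltW.
split; exists (c1 / c2), (c2 / c1), 1%N; rewrite !divr_gt0 //; do 2![split=> //].
  by move=> N lam _ ev j jN; apply: ratio.
by move=> N lam N1 ev; have := ratio N lam 0%N N1 ev; rewrite divr1.
Qed.
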